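(* Let $K$ be a field and $\mathbb M$ a $\mathcal K$-module. Let $\{\mathcal N_i\}_{i\in I}$ be the family of all quasi-coherent quotient modules of $\mathbb M$ (i.e. epimorphisms $\mathbb M\to\mathcal N_i$ onto quasi-coherent $\mathcal K$-modules, up to isomorphism under $\mathbb M$), ordered by $\mathcal N_j\le\mathcal N_i$ if $\mathbb M\to\mathcal N_i$ factors through $\mathbb M\to\mathcal N_j$. Then $\mathbb M$ is dually separated if and only if $I$ is a set which is downward directed and the natural morphism $\varinjlim_{i\in I}\mathcal N_i^*\to\mathbb M^*$ (dual to the quotient maps) is an isomorphism.
   Context: For a commutative ring $R$ (here $R=K$), an $\mathcal R$-module is a covariant functor $\mathbb M$ from commutative $R$-algebras to abelian groups with each $\mathbb M(S)$ an $S$-module, functorially; morphisms are natural transformations that are $S$-linear on each $S$. For an $R$-module $N$, $\mathcal N(S)=N\otimes_R S$ (quasi-coherent module). $\mathbb M^*(S)=\operatorname{Hom}_{\mathcal S}(\mathbb M_{|S},\mathcal S)$ where $\mathbb M_{|S}$ is restriction to $S$-algebras. $\mathbb M$ is dually separated if for every commutative $R$-algebra $S$ the map $\mathbb M^*(S)\to\operatorname{Hom}_R(\mathbb M(R),S)$, $w\mapsto w_R$, is injective. *)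

(* Defs.v *)
From HB Require Import structures.
From mathcomp Require Import all_boot all_algebra.
Set Implicit Arguments.
Unset Strict Implicit.
Unset Printing Implicit Defensive.
Import GRing.Theory.
Local Open Scope ring_scope.

(* Size conventions.  "Sets" are the types of the universe in which the
   carriers of commutative K-algebras (and of modules) live.  We identify
   the carrier universes of comAlgType and lmodType, and call a type of
   that universe "small" (a set); the collection of all quasi-coherent
   quotients of a module a priori lives one universe higher (a class).  *)
Definition SmallType := Type@{GRing.ComAlgebra.axioms_.u0}.
Definition small_univ_link1 (T : Type@{GRing.Lmodule.axioms_.u0}) :
  Type@{GRing.ComAlgebra.axioms_.u0} := T.
Definition small_univ_link2 (T : Type@{GRing.ComAlgebra.axioms_.u0}) :
  Type@{GRing.Lmodule.axioms_.u0} := T.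

Section KModules.
Variable K : fieldType.

Local Notation alg := (comAlgType K).
Local Notation hom S T := {lrmorphism S%type -> T%type}.

Definition unit_map (S : alg) (k : K^o) : S := k%:A.
Fact unit_map_nmod (S : alg) : nmod_morphism (@unit_map S).
Proof. by split; [exact: scale0r | move=> x y; exact: scalerDl]. Qed.
HB.instance Definition _ (S : alg) :=
  GRing.isNmodMorphism.Build K^o S (@unit_map S) (@unit_map_nmod S).
Fact unit_map_monoid (S : alg) : monoid_morphism (@unit_map S).
Proof. split; first exact: scale1r. by move=> x y; rewrite /unit_map -scalerA mulr_algl. Qed.
HB.instance Definition _ (S : alg) :=
  GRing.isMonoidMorphism.Build K^o S (@unit_map S) (@unit_map_monoid S).
Fact unit_map_scalable (S : alg) : scalable (@unit_map S).
Proof. by move=> k a; rewrite /unit_map scalerA. Qed.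
HB.instance Definition _ (S : alg) :=
  GRing.isScalable.Build K K^o S *:%R (@unit_map S) (@unit_map_scalable S).

Definition unit_hom (S : alg) : hom K^o S := @unit_map S.
Definition id_hom (S : alg) : hom S S := idfun.

Record KMod := {
  kob :> forall S : alg, lmodType S;
  kmap : forall (S T : alg), hom S T -> kob S -> kob T;
  kmapD : forall (S T : alg) (f : hom S T) (x y : kob S),
      kmap f (x + y) = kmap f x + kmap f y;
  kmapZ : forall (S T : alg) (f : hom S T) (a : S) (x : kob S),
      kmap f (a *: x) = f a *: kmap f x;
  kmap_id : forall (S : alg) (f : hom S S), (forall a, f a = a) ->
      forall x : kob S, kmap f x = x;
  kmap_comp : forall (S T U : alg) (f : hom S T) (g : hom T U) (h : hom S U),
      (forall a, h a = g (f a)) ->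
      forall x : kob S, kmap h x = kmap g (kmap f x)
}.
Arguments kmap _ {S T}.

Record KHom (M N : KMod) := {
  hcomp :> forall S : alg, M S -> N S;
  hcompD : forall (S : alg) (x y : M S), hcomp (x + y) = hcomp x + hcomp y;
  hcompZ : forall (S : alg) (a : S) (x : M S), hcomp (a *: x) = a *: hcomp x;
  hcomp_nat : forall (S T : alg) (f : hom S T) (x : M S),
      hcomp (kmap M f x) = kmap N f (hcomp x)
}.
Arguments hcomp {M N} _ {S}.

(* Elements of the dual M^*(S) = Hom_S(M_{|S}, \mathcal S).  An S-algebra
   is a commutative K-algebra T with a K-algebra map i : S -> T; the
   component at (T,i) is a T-linear map M(T) -> T; naturality is with
   respect to morphisms of S-algebras. *)
Record dual_elt (M : KMod) (S : alg) := {
  dcomp : forall (T : alg), hom S T -> M T -> T;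
  dcompD : forall (T : alg) (i : hom S T) (x y : M T),
      dcomp i (x + y) = dcomp i x + dcomp i y;
  dcompZ : forall (T : alg) (i : hom S T) (a : T) (x : M T),
      dcomp i (a *: x) = a * dcomp i x;
  dcomp_nat : forall (T T' : alg) (i : hom S T) (i' : hom S T') (f : hom T T'),
      (forall a, i' a = f (i a)) ->
      forall x : M T, dcomp i' (kmap M f x) = f (dcomp i x)
}.
Arguments dcomp {M S} _ {T}.

Definition dual_eq (M : KMod) (S : alg) (w w' : dual_elt M S) : Prop :=
  forall (T : alg) (i : hom S T) (x : M T), dcomp w i x = dcomp w' i x.

Definition dually_separated (M : KMod) : Prop :=
  forall (S : alg) (w w' : dual_elt M S),
    (forall m : M K^o, dcomp w (id_hom S) (kmap M (unit_hom S) m)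
                       = dcomp w' (id_hom S) (kmap M (unit_hom S) m)) ->
    dual_eq w w'.

(* Quasi-coherence: the natural map N(K) (x)_K S -> N(S) is an isomorphism
   for every S, i.e. N(K) -> N(S) is universal among K-linear maps from N(K)
   into S-modules (universal property of the scalar extension N(K) (x)_K S).
   Equivalently N is isomorphic to the quasi-coherent module of N(K). *)
Definition quasi_coherent (N : KMod) : Prop :=
  forall (S : alg) (P : lmodType S) (g : N K^o -> P),
    (forall (k : K^o) (x y : N K^o), g (k *: x + y) = unit_map S k *: g x + g y) ->
    (exists h : N S -> P,
        (forall (a : S) (x y : N S), h (a *: x + y) = a *: h x + h y) /\
        (forall x : N K^o, h (kmap N (unit_hom S) x) = g x)) /\
    (forall h h' : N S -> P,
        (forall (a : S) (x y : N S), h (a *: x + y) = a *: h x + h y) ->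
        (forall (a : S) (x y : N S), h' (a *: x + y) = a *: h' x + h' y) ->
        (forall x : N K^o, h (kmap N (unit_hom S) x) = h' (kmap N (unit_hom S) x)) ->
        forall y : N S, h y = h' y).

Definition epi (M N : KMod) (f : KHom M N) : Prop :=
  forall (S : alg) (y : N S), exists x : M S, f S x = y.

Record Quot (M : KMod) := {
  qmod : KMod;
  qpi : KHom M qmod;
  qqc : quasi_coherent qmod;
  qepi : epi qpi
}.
Arguments qmod {M}.
Arguments qpi {M}.

Definition quot_le (M : KMod) (Q1 Q2 : Quot M) : Prop :=
  exists phi : KHom (qmod Q1) (qmod Q2),
    forall (S : alg) (x : M S), phi S (qpi Q1 S x) = qpi Q2 S x.

Definition quot_iso (M : KMod) (Q1 Q2 : Quot M) : Prop :=
  exists (phi : KHom (qmod Q1) (qmod Q2)) (psi : KHom (qmod Q2) (qmod Q1)),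
    [/\ forall (S : alg) (y : qmod Q1 S), psi S (phi S y) = y,
        forall (S : alg) (z : qmod Q2 S), phi S (psi S z) = z &
        forall (S : alg) (x : M S), phi S (qpi Q1 S x) = qpi Q2 S x].

Definition quotients_small (M : KMod) : Prop :=
  exists (J : SmallType) (q : J -> Quot M), forall Q : Quot M, exists j, quot_iso Q (q j).

Definition quotients_directed (M : KMod) : Prop :=
  inhabited (Quot M) /\
  forall Q1 Q2 : Quot M, exists Q3 : Quot M, quot_le Q3 Q1 /\ quot_le Q3 Q2.

(* The natural morphism lim_{->} N_i^* -> M^*, (i, v) |-> v o pi_i, is an
   isomorphism.  Direct limits of K-modules are computed componentwise, and
   for a directed system the direct limit at S is the set of pairs (i, v),
   v in N_i^*(S), modulo (i,v) ~ (j,v') iff there is k <= i, j with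
   v o t_ki = v' o t_kj.  Being an isomorphism of K-modules means being
   bijective at every S. *)
Definition dual_colimit_iso (M : KMod) : Prop :=
  forall S : alg,
    (forall w : dual_elt M S, exists (Q : Quot M) (v : dual_elt (qmod Q) S),
        forall (T : alg) (i : hom S T) (x : M T), dcomp w i x = dcomp v i (qpi Q T x)) /\
    (forall (Q1 Q2 : Quot M) (v1 : dual_elt (qmod Q1) S) (v2 : dual_elt (qmod Q2) S),
        (forall (T : alg) (i : hom S T) (x : M T),
            dcomp v1 i (qpi Q1 T x) = dcomp v2 i (qpi Q2 T x)) ->
        exists (Q3 : Quot M) (t1 : KHom (qmod Q3) (qmod Q1)) (t2 : KHom (qmod Q3) (qmod Q2)),
          [/\ forall (T : alg) (x : M T), t1 T (qpi Q3 T x) = qpi Q1 T x,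
              forall (T : alg) (x : M T), t2 T (qpi Q3 T x) = qpi Q2 T x &
              forall (T : alg) (i : hom S T) (y : qmod Q3 T),
                dcomp v1 i (t1 T y) = dcomp v2 i (t2 T y)]).

End KModules.

(* Main.v *)
(* Let M be dually separated.  Two morphisms p, p' from M to a quasi-coherent N
   that agree on M(K) are equal: compose them with the tautological functional
   N -> S over the square-zero algebra S = K (+) N(K), and test the resulting
   elements of M^*(S) over T (+) N(T).  Hence a quasi-coherent quotient is
   determined by its kernel on M(K), which makes the class of quotients small.

   A morphism p : M -> N to a quasi-coherent N factors through a quasi-coherent
   quotient of M: let e be a linear projection of N(K) onto V = p(M(K)), extended
   to N; then e p and p agree on M(K), hence are equal, so p corestricts to an
   epimorphism from M onto the quasi-coherent module of V.  Applied to the pairing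
   M -> N1 x N2 of two quotients this gives directedness.  Applied to the morphism
   from M to the quasi-coherent module of S adjoint to w in M^*(S), it shows that
   w comes from a quasi-coherent quotient.

   Conversely quasi-coherent modules are dually separated, and two elements of
   M^*(S) coming from quotients come from a common one by directedness. *)

Require Import Defs.
From HB Require Import structures.
From mathcomp Require Import all_boot all_algebra.
From mathcomp Require Import boolp classical_sets.
Set Implicit Arguments.
Unset Strict Implicit.
Unset Printing Implicit Defensive.
Import GRing.Theory.
Local Open Scope ring_scope.
Local Open Scope quotient_scope.

Arguments kmap {K} _ {S T}.

(** * Linear projections onto subspaces *)

Section Complement.
Variables (K : fieldType) (U : lmodType K) (W : U -> Prop).
Hypothesis W0 : W 0.
Hypothesis Wlin : forall k x y, W x -> W y -> W (k *: x + y).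

(** Zorn's lemma yields a maximal subspace meeting [W] trivially. Maximality makes it a complement
    of [W], and [e] is the projection along it; uniqueness of the decomposition gives linearity. *)
Lemma subspace_projection : exists e : U -> U,
  [/\ linear e, forall x, W (e x) & forall x, W x -> e x = x].
Proof.
have WB x y : W x -> W y -> W (y - x).
  by move=> Wx Wy; rewrite addrC -scaleN1r; apply: Wlin.
(* Membership of 0 is not demanded: the union of the empty chain is empty and must qualify. The set
   [C] below puts 0 back. *)
pose indep (A : set U) :=
  (forall k x y, A x -> A y -> A (k *: x + y)) /\ (forall x, A x -> W x -> x = 0).
have [|A [[Alin AW] Amax]] := @Zorn_bigcup U indep.
  move=> F Findep Ftot; split=> [k x y [B FB Bx] [C FC Cy]|x [B FB Bx]]; last first.
    exact: (Findep B FB).2.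
  have [/(_ _ Bx) Cx|/(_ _ Cy) By] := Ftot B C FB FC.
    by exists C => //; apply: (Findep C FC).1.
  by exists B => //; apply: (Findep B FB).1.
pose C x := x = 0 \/ A x.
have C0 : C 0 by left.
have Clin k x y : C x -> C y -> C (k *: x + y).
  move=> [->|Ax] [->|Ay]; rewrite ?scaler0 ?addr0 ?add0r; try by [left|right].
    right; have A0 : A 0 by rewrite -(addNr x) -scaleN1r; apply: Alin.
    by rewrite -[_ *: _]addr0; apply: Alin.
  by right; apply: Alin.
have CW x : C x -> W x -> x = 0 by move=> [//|/AW].
have decomp x : exists w, W w /\ C (x - w).
  apply: contrapT => nx.
  (* If [x] has no decomposition, the span of [x] and [C] strictly contains [A]. It still meets [W]
     trivially: a vector [k *: x + c] of [W] with [k] nonzero would decompose [x] after division by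
     [k]. *)
  pose B y := exists k c, C c /\ y = k *: x + c.
  apply: (Amax B).
    split=> [y Ay|]; first by exists 0, y; split; [right|rewrite scale0r add0r].
    move=> BA; apply: nx; exists 0; split=> //; rewrite subr0; right.
    by apply: BA; exists 1, 0; rewrite scale1r addr0.
  split=> [k y z [a [c [Cc ->]]] [b [d [Cd ->]]]|y [k [c [Cc ->]]]].
    exists (k * a + b), (k *: c + d); split; first exact: Clin.
    by rewrite scalerDl scalerDr scalerA addrACA.
  have [->|k0] := eqVneq k 0; first by rewrite scale0r add0r; apply: CW.
  move=> Wy; case: nx; exists (k^-1 *: (k *: x + c)); split.
    by rewrite -[_ *: _]addr0; apply: Wlin.
  rewrite scalerDr scalerA mulVf // scale1r opprD addNKr -scaleNr.
  by rewrite -[_ *: _]addr0; apply: Clin.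
have {decomp} [e e_spec] := choice decomp.
have uniq x w : W w -> C (x - w) -> e x = w.
  have [We Ce] := e_spec x; move=> Ww Cw.
  apply/eqP; rewrite -subr_eq0; apply/eqP/CW; last exact: WB.
  have -> : e x - w = (-1) *: (x - e x) + (x - w).
    by rewrite scaleN1r opprB addrA subrK.
  exact: Clin.
exists e; split=> [k x y|x|x Wx]; last first.
- by apply: uniq => //; rewrite subrr.
- exact: (e_spec x).1.
have [[Wx Cx] [Wy Cy]] := (e_spec x, e_spec y).
apply: uniq; first exact: Wlin.
have -> : k *: x + y - (k *: e x + e y) = k *: (x - e x) + (y - e y).
  by rewrite scalerBr opprD addrACA.
exact: Clin.
Qed.

End Complement.

(** * Tensor products *)

(* [tens V T] is the quotient of lists of pairs by the relation that no balanced
   map, with values in any abelian group, separates; its universal property is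
   then immediate. *)
Section TensorProduct.
Variables (K : fieldType) (V T : lmodType K).

Definition balanced (P : zmodType) (b : V -> T -> P) :=
  [/\ forall v v' t, b (v + v') t = b v t + b v' t,
      forall v t t', b v (t + t') = b v t + b v t' &
      forall (k : K) v t, b (k *: v) t = b v (k *: t)].

Definition pairing (P : zmodType) (b : V -> T -> P) (r : seq (V * T)) : P :=
  \sum_(p <- r) b p.1 p.2.

Definition tens_eq (r r' : seq (V * T)) : bool :=
  `[< forall (P : zmodType) (b : V -> T -> P),
        balanced b -> pairing b r = pairing b r' >].

Lemma tens_eq_refl : reflexive tens_eq.
Proof. by move=> r; apply/asboolP. Qed.

Lemma tens_eq_sym : symmetric tens_eq.
Proof. by move=> r s; apply/asboolP/asboolP => rs P b /rs. Qed.

Lemma tens_eq_trans : transitive tens_eq.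
Proof.
by move=> s r q /asboolP rs /asboolP sq; apply/asboolP => P b bb; rewrite rs ?sq.
Qed.

Canonical tens_equiv := EquivRel tens_eq tens_eq_refl tens_eq_sym tens_eq_trans.

Definition tens := {eq_quot tens_equiv}.
HB.instance Definition _ := EqQuotient.on tens.
HB.instance Definition _ := Choice.on tens.

(** The value is computed on a chosen representative, so [b] can be any function; balancedness
    enters as a hypothesis of the lemmas. *)
Definition tens_lift (P : zmodType) (b : V -> T -> P) (x : tens) : P := pairing b (repr x).

Lemma tens_lift_pi (P : zmodType) (b : V -> T -> P) r :
  balanced b -> tens_lift b (\pi_tens r) = pairing b r.
Proof.
move=> bb; rewrite /tens_lift; have /eqmodP/asboolP := reprK (\pi_tens r).
exact.
Qed.

Lemma tens_ext (x y : tens) :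
  (forall (P : zmodType) (b : V -> T -> P), balanced b -> tens_lift b x = tens_lift b y) -> x = y.
Proof.
by move=> xy; rewrite -[x]reprK -[y]reprK; apply/eqmodP/asboolP.
Qed.

Definition tens0 : tens := \pi_tens [::].
Definition tens_add (x y : tens) : tens := \pi_tens (repr x ++ repr y).
Definition tens_opp (x : tens) : tens := \pi_tens [seq (- p.1, p.2) | p <- repr x].

Lemma balanced0 (P : zmodType) (b : V -> T -> P) t : balanced b -> b 0 t = 0.
Proof. by case=> bDl _ _; apply: (@addrI _ (b 0 t)); rewrite -bDl !addr0. Qed.

Lemma balancedN (P : zmodType) (b : V -> T -> P) v t :
  balanced b -> b (- v) t = - b v t.
Proof.
move=> bb; apply/eqP; rewrite -addr_eq0; case: (bb) => <- _ _.
by rewrite addNr balanced0.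
Qed.

Lemma tens_lift_add (P : zmodType) (b : V -> T -> P) x y :
  balanced b -> tens_lift b (tens_add x y) = tens_lift b x + tens_lift b y.
Proof. by move=> bb; rewrite tens_lift_pi // /pairing big_cat. Qed.

Lemma tens_lift_opp (P : zmodType) (b : V -> T -> P) x :
  balanced b -> tens_lift b (tens_opp x) = - tens_lift b x.
Proof.
move=> bb; rewrite tens_lift_pi // /tens_lift /pairing big_map -sumrN.
by apply: eq_bigr => p _; apply: balancedN.
Qed.

Lemma tens_lift_0 (P : zmodType) (b : V -> T -> P) : balanced b -> tens_lift b tens0 = 0.
Proof. by move=> bb; rewrite tens_lift_pi // /pairing big_nil. Qed.

Lemma tens_addA : associative tens_add.
Proof. by move=> x y z; apply: tens_ext => P b bb; rewrite !tens_lift_add // addrA. Qed.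
Lemma tens_addC : commutative tens_add.
Proof. by move=> x y; apply: tens_ext => P b bb; rewrite !tens_lift_add // addrC. Qed.
Lemma tens_add0 : left_id tens0 tens_add.
Proof. by move=> x; apply: tens_ext => P b bb; rewrite tens_lift_add // tens_lift_0 // add0r. Qed.
Lemma tens_addN : left_inverse tens0 tens_opp tens_add.
Proof.
by move=> x; apply: tens_ext => P b bb; rewrite tens_lift_add // tens_lift_opp // tens_lift_0 // addNr.
Qed.

HB.instance Definition _ :=
  GRing.isZmodule.Build tens tens_addA tens_addC tens_add0 tens_addN.

Lemma tens_liftD (P : zmodType) (b : V -> T -> P) x y :
  balanced b -> tens_lift b (x + y) = tens_lift b x + tens_lift b y.
Proof. exact: tens_lift_add. Qed.

Definition pure (v : V) (t : T) : tens := \pi_tens [:: (v, t)].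

Lemma tens_lift_pure (P : zmodType) (b : V -> T -> P) v t :
  balanced b -> tens_lift b (pure v t) = b v t.
Proof. by move=> bb; rewrite tens_lift_pi // /pairing big_seq1. Qed.

Lemma pure_balanced : balanced pure.
Proof.
split=> *; apply: tens_ext => P b bb; rewrite ?tens_liftD ?tens_lift_pure //; by case: bb.
Qed.

Lemma pureDl v v' t : pure (v + v') t = pure v t + pure v' t.
Proof. by case: pure_balanced. Qed.
Lemma pureDr v t t' : pure v (t + t') = pure v t + pure v t'.
Proof. by case: pure_balanced. Qed.
Lemma pureZ (k : K) v t : pure (k *: v) t = pure v (k *: t).
Proof. by case: pure_balanced. Qed.

Lemma tens_ind (Q : tens -> Prop) :
  (forall v t, Q (pure v t)) -> (forall x y, Q x -> Q y -> Q (x + y)) ->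
  forall x, Q x.
Proof.
move=> Qp QD; apply: quotW => r.
have -> : \pi_tens r = \sum_(p <- r) pure p.1 p.2.
  apply: tens_ext => P b bb; rewrite tens_lift_pi //.
  elim: r => [|p r IHr]; first by rewrite /pairing !big_nil tens_lift_0.
  by rewrite /pairing !big_cons tens_liftD // tens_lift_pure // -IHr.
(* The empty sum is covered by the pure case, since zero is itself a pure tensor. *)
apply: big_ind => //; suff -> : 0 = pure 0 0 by [].
by apply: tens_ext => P b bb; rewrite tens_lift_0 // tens_lift_pure // balanced0.
Qed.

Lemma tens_eq_on_pure (P : zmodType) (f g : tens -> P) :
  {morph f : x y / x + y} -> {morph g : x y / x + y} ->
  (forall v t, f (pure v t) = g (pure v t)) -> f =1 g.
Proof. by move=> fD gD fg; apply: tens_ind => // x y fx fy; rewrite fD gD fx fy. Qed.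

End TensorProduct.

(** * Extension of scalars of a vector space to an algebra *)

Section TensorModule.
Variables (K : fieldType) (V : lmodType K) (T : comAlgType K).

Definition tens_scale (a : T) (x : tens V T) : tens V T :=
  tens_lift (fun v t => pure v (a * t)) x.

Lemma tens_scale_balanced (a : T) : balanced (fun v t => pure v (a * t) : tens V T).
Proof.
split=> *; first by rewrite pureDl.
  by rewrite mulrDr pureDr.
by rewrite pureZ scalerAr.
Qed.

Lemma tens_scale_pure a v t : tens_scale a (pure v t) = pure v (a * t).
Proof. exact/tens_lift_pure/tens_scale_balanced. Qed.

Lemma tens_scaleDr : right_distributive tens_scale +%R.
Proof. by move=> a x y; apply/tens_liftD/tens_scale_balanced. Qed.

Lemma tens_scaleA a b x : tens_scale a (tens_scale b x) = tens_scale (a * b) x.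
Proof.
elim/tens_ind: x => [v t|x y IHx IHy]; last by rewrite !tens_scaleDr IHx IHy.
by rewrite !tens_scale_pure mulrA.
Qed.

Lemma tens_scale1 : left_id 1 tens_scale.
Proof.
elim/tens_ind=> [v t|x y IHx IHy]; last by rewrite tens_scaleDr IHx IHy.
by rewrite tens_scale_pure mul1r.
Qed.

Lemma tens_scaleDl x : {morph tens_scale^~ x : a b / a + b}.
Proof.
move=> a b; elim/tens_ind: x => [v t|x y IHx IHy].
  by rewrite !tens_scale_pure mulrDl pureDr.
by rewrite !tens_scaleDr IHx IHy addrACA.
Qed.

HB.instance Definition _ := GRing.Zmodule_isLmodule.Build T (tens V T)
  tens_scaleA tens_scale1 tens_scaleDr tens_scaleDl.

Lemma scale_pure (a : T) v t : a *: (pure v t : tens V T) = pure v (a * t).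
Proof. exact: tens_scale_pure. Qed.

(** The lift of this balanced map is the extension of [g] to [tens V T], which supplies the
    existence half of quasi-coherence. *)
Lemma extension_balanced (P : lmodType T) (g : V -> P) :
  (forall (k : K) x y, g (k *: x + y) = k%:A *: g x + g y) ->
  balanced (fun v t => t *: g v).
Proof.
move=> glin.
have gD x y : g (x + y) = g x + g y by rewrite -[x]scale1r glin !scale1r.
have gZ k x : g (k *: x) = k%:A *: g x.
  have g0 : g 0 = 0 by apply: (addrI (g 0)); rewrite -gD !addr0.
  by rewrite -[in LHS](addr0 (k *: x)) glin g0 addr0.
split=> [v v' t|v t t'|k v t]; first by rewrite gD scalerDr.
  by rewrite scalerDl.
by rewrite gZ scalerA mulr_algr.
Qed.

End TensorModule.

(** * The quasi-coherent module of a vector space *)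

Section TensorFunctor.
Variables (K : fieldType) (V : lmodType K).

Definition tens_map (S T : comAlgType K) (f : {lrmorphism S -> T}) : tens V S -> tens V T :=
  tens_lift (fun v t => pure v (f t)).

Lemma tens_map_balanced (S T : comAlgType K) (f : {lrmorphism S -> T}) :
  balanced (fun v t => pure v (f t) : tens V T).
Proof.
split=> *; first by rewrite pureDl.
  by rewrite rmorphD pureDr.
by rewrite pureZ linearZ.
Qed.

Lemma tens_map_pure (S T : comAlgType K) (f : {lrmorphism S -> T}) v t :
  tens_map f (pure v t) = pure v (f t).
Proof. exact/tens_lift_pure/tens_map_balanced. Qed.

Lemma tens_mapD (S T : comAlgType K) (f : {lrmorphism S -> T}) : {morph tens_map f : x y / x + y}.
Proof. by move=> x y; apply/tens_liftD/tens_map_balanced. Qed.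

Lemma tens_mapZ (S T : comAlgType K) (f : {lrmorphism S -> T}) (a : S) (x : tens V S) :
  tens_map f (a *: x) = f a *: tens_map f x.
Proof.
elim/tens_ind: x => [v t|x y IHx IHy]; last by rewrite scalerDr !tens_mapD scalerDr IHx IHy.
by rewrite scale_pure !tens_map_pure scale_pure rmorphM.
Qed.

Lemma tens_map_id (S : comAlgType K) (f : {lrmorphism S -> S}) :
  (forall a, f a = a) -> forall x, tens_map f x = x.
Proof.
by move=> fE; elim/tens_ind => [v t|x y IHx IHy]; rewrite ?tens_map_pure ?tens_mapD ?fE ?IHx ?IHy.
Qed.

Lemma tens_map_comp (S T U : comAlgType K) (f : {lrmorphism S -> T})
    (g : {lrmorphism T -> U}) (h : {lrmorphism S -> U}) :
  (forall a, h a = g (f a)) -> forall x, tens_map h x = tens_map g (tens_map f x).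
Proof.
move=> hE; elim/tens_ind => [v t|x y IHx IHy]; last by rewrite !tens_mapD IHx IHy.
by rewrite !tens_map_pure hE.
Qed.

Definition tensMod : KMod K :=
  @Build_KMod K (fun T => tens V T) tens_map tens_mapD tens_mapZ tens_map_id tens_map_comp.

Lemma tensMod_quasi_coherent : quasi_coherent tensMod.
Proof.
move=> T P g glin; split=> [|h h' hlin h'lin hh'].
  (* The value of [tensMod] at K is V (x) K rather than V itself; v -> v (x) 1 identifies the
     two. *)
  pose g1 (v : V) := g (pure v (1 : K^o)).
  have bg : balanced (fun v (t : T) => t *: g1 v).
    apply: extension_balanced => k x y; rewrite /g1 -glin; congr g.
    by rewrite scale_pure pureDl pureZ mulr1; congr (pure _ _ + _); rewrite /GRing.scale /= mulr1.
  exists (tens_lift (fun v (t : T) => t *: g1 v)); split=> [a x y|x].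
    rewrite tens_liftD //; congr (_ + _).
    elim/tens_ind: x => [v t|x z IHx IHz]; last by rewrite scalerDr !tens_liftD // scalerDr IHx IHz.
    by rewrite scale_pure !tens_lift_pure // scalerA.
  have g0D : {morph g : x y / x + y}.
    by move=> a b; rewrite -[a]scale1r glin /unit_map !scale1r.
  have g0 : g 0 = 0 by apply: (addrI (g 0)); rewrite -g0D !addr0.
  suff E : tens_lift (fun v (t : T) => t *: g1 v) \o kmap tensMod (unit_hom T) =1 g.
    exact: E.
  apply: (@tens_eq_on_pure K V K^o P) => // [y z|v k] /=.
    by rewrite tens_mapD tens_liftD.
  rewrite tens_map_pure tens_lift_pure // /g1.
  by rewrite -[LHS]addr0 -g0 -glin addr0 scale_pure mulr1.
have hD : {morph h : x y / x + y} by move=> a b; rewrite -[a]scale1r hlin !scale1r.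
have h'D : {morph h' : x y / x + y} by move=> a b; rewrite -[a]scale1r h'lin !scale1r.
have h0 : h 0 = 0 by apply: (addrI (h 0)); rewrite -hD !addr0.
have h'0 : h' 0 = 0 by apply: (addrI (h' 0)); rewrite -h'D !addr0.
apply: (@tens_eq_on_pure K V T P h h') => // v t.
(* Uniqueness: v (x) t is [t] times an element coming from K, where [h] and [h'] agree. The summand
   0 gives the shape required by the linearity hypotheses. *)
have -> : pure v t = t *: kmap tensMod (unit_hom T) (pure v (1 : K^o)) + 0.
  by rewrite addr0 /= tens_map_pure scale_pure rmorph1 mulr1.
by rewrite hlin h'lin hh' h0 h'0.
Qed.

End TensorFunctor.

(** Project onto the line spanned by [u] and read off the coordinate. *)
Lemma exists_functional (K : fieldType) (U : lmodType K) (u : U) :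
  u != 0 -> exists l : U -> K, linear_for *%R l /\ l u = 1.
Proof.
move=> u0; pose W (x : U) := exists k : K, x = k *: u.
have W0 : W 0 by exists 0; rewrite scale0r.
have Wlin k x y : W x -> W y -> W (k *: x + y).
  by move=> [a ->] [b ->]; exists (k * a + b); rewrite scalerDl scalerA.
have [e [elin /choice [l lP] eW]] := subspace_projection W0 Wlin.
have inj : injective (fun k : K => k *: u).
  move=> a b /eqP; rewrite -subr_eq0 -scalerBl scaler_eq0 (negPf u0) orbF subr_eq0.
  by move/eqP.
exists l; split=> [k x y|]; apply: inj.
  by rewrite -lP elin !lP scalerDl scalerA.
by rewrite -lP scale1r eW //; exists 1; rewrite scale1r.
Qed.

(** * The tensor product of two commutative algebras *)

Section TensorAlgebra.
Variables (K : fieldType) (S T : comAlgType K).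

(* A copy of [tens S T] carrying the K-module structure instead of the T-module one. *)
Definition tensA := tens S T.
HB.instance Definition _ := GRing.Zmodule.copy tensA (tens S T).

Implicit Types x y z : tensA.

Definition tensA_one : tensA := pure 1 1.
Definition tensA_mul x y : tensA :=
  tens_lift (fun s t => tens_lift (fun s' t' => pure (s * s') (t * t') : tensA) y) x.

Lemma tensA_mul_balancedr s t : balanced (fun s' t' => pure (s * s') (t * t') : tensA).
Proof.
split=> *; first by rewrite mulrDr; exact: pureDl.
  by rewrite mulrDr; exact: pureDr.
by rewrite -!scalerAr pureZ.
Qed.

Lemma tensA_mul_balancedl y :
  balanced (fun s t => tens_lift (fun s' t' => pure (s * s') (t * t') : tensA) y).
Proof.
have bb := tensA_mul_balancedr.
split=> *; elim/tens_ind: y => [s' t'|x y IHx IHy].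
- by rewrite !tens_lift_pure // mulrDl; exact: pureDl.
- by rewrite !tens_liftD // IHx IHy addrACA.
- by rewrite !tens_lift_pure // mulrDl; exact: pureDr.
- by rewrite !tens_liftD // IHx IHy addrACA.
- by rewrite !tens_lift_pure // -!scalerAl pureZ.
- by rewrite !tens_liftD // IHx IHy.
Qed.

Lemma tensA_mul_pure s t s' t' :
  tensA_mul (pure s t) (pure s' t') = pure (s * s') (t * t').
Proof.
rewrite /tensA_mul tens_lift_pure; last exact: tensA_mul_balancedl.
exact/tens_lift_pure/tensA_mul_balancedr.
Qed.

Lemma tensA_mulDl : left_distributive tensA_mul +%R.
Proof. by move=> x y z; apply/tens_liftD/tensA_mul_balancedl. Qed.

Lemma tensA_mulC : commutative tensA_mul.
Proof.
have mulDr x y z : tensA_mul x (y + z) = tensA_mul x y + tensA_mul x z.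
  elim/tens_ind: x => [s t|x x' IHx IHx']; last by rewrite !tensA_mulDl IHx IHx' addrACA.
  rewrite /tensA_mul !tens_lift_pure; try exact: tensA_mul_balancedl.
  exact/tens_liftD/tensA_mul_balancedr.
move=> x y; elim/tens_ind: x => [s t|x x' IHx IHx'].
  elim/tens_ind: y => [s' t'|y y' IHy IHy']; last by rewrite mulDr tensA_mulDl IHy IHy'.
  by rewrite !tensA_mul_pure mulrC [t * _]mulrC.
by rewrite mulDr tensA_mulDl IHx IHx'.
Qed.

Lemma tensA_mulDr : right_distributive tensA_mul +%R.
Proof. by move=> x y z; rewrite ![tensA_mul x _]tensA_mulC tensA_mulDl. Qed.

Lemma tensA_mulA : associative tensA_mul.
Proof.
move=> x y z; elim/tens_ind: x => [s t|x x' IHx IHx']; last by rewrite !tensA_mulDl IHx IHx'.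
elim/tens_ind: y => [s' t'|y y' IHy IHy']; last by rewrite !(tensA_mulDl, tensA_mulDr) IHy IHy'.
elim/tens_ind: z => [s'' t''|z z' IHz IHz']; last by rewrite !tensA_mulDr IHz IHz'.
by rewrite !tensA_mul_pure !mulrA.
Qed.

Lemma tensA_mul1 : left_id tensA_one tensA_mul.
Proof.
elim/tens_ind=> [s t|x y IHx IHy]; last by rewrite tensA_mulDr IHx IHy.
by rewrite tensA_mul_pure !mul1r.
Qed.

(** Algebras are nonzero rings here, so this must be proved. A functional [l] on S with [l 1 = 1]
    induces s (x) t -> l(s) t, which sends 1 (x) 1 to 1 in T. *)
Lemma tensA_one_neq0 : tensA_one != 0.
Proof.
have [l [llin l1]] := exists_functional (oner_neq0 S).
have lD (x y : S) : l (x + y) = l x + l y by rewrite -[x]scale1r llin mul1r scale1r.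
have lZ k (x : S) : l (k *: x) = k * l x.
  have l0 : l 0 = 0 by apply: (addrI (l 0)); rewrite -lD !addr0.
  by rewrite -[in LHS](addr0 (k *: x)) llin l0 addr0.
have bb : balanced (fun s (t : T) => l s *: t).
  split=> *; first by rewrite lD scalerDl.
    by rewrite scalerDr.
  by rewrite lZ mulrC scalerA.
apply/eqP => /(congr1 (tens_lift (fun s (t : T) => l s *: t))).
rewrite tens_lift_pure // l1 scale1r => /esym/eqP; apply/negP.
by rewrite (tens_lift_0 bb) eq_sym oner_neq0.
Qed.

HB.instance Definition _ := GRing.Zmodule_isComNzRing.Build tensA
  tensA_mulA tensA_mulC tensA_mul1 tensA_mulDl tensA_one_neq0.

Definition tensA_scale (k : K) (x : tensA) : tensA := (k%:A : T) *: (x : tens S T).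

Lemma tensA_scaleA a b x : tensA_scale a (tensA_scale b x) = tensA_scale (a * b) x.
Proof. by rewrite /tensA_scale scalerA -scalerAl mul1r scalerA. Qed.
Lemma tensA_scale1 : left_id 1 tensA_scale.
Proof. by move=> x; rewrite /tensA_scale !scale1r. Qed.
Lemma tensA_scaleDr : right_distributive tensA_scale +%R.
Proof. by move=> a x y; apply: scalerDr. Qed.
Lemma tensA_scaleDl x : {morph tensA_scale^~ x : a b / a + b}.
Proof. by move=> a b; rewrite /tensA_scale !scalerDl. Qed.

HB.instance Definition _ := GRing.Zmodule_isLmodule.Build K tensA
  tensA_scaleA tensA_scale1 tensA_scaleDr tensA_scaleDl.

Lemma mul_pure s t s' t' :
  (pure s t : tensA) * (pure s' t' : tensA) = (pure (s * s') (t * t') : tensA).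
Proof. exact: tensA_mul_pure. Qed.

Lemma tensA_scale_pure (k : K) s t : k *: (pure s t : tensA) = (pure s (k *: t) : tensA).
Proof. by rewrite [LHS]scale_pure mulr_algl. Qed.

Lemma tensA_scaleAl (k : K) x y : k *: (x * y) = (k *: x) * y.
Proof.
elim/tens_ind: x => [s t|x x' IHx IHx']; last by rewrite mulrDl !scalerDr mulrDl IHx IHx'.
elim/tens_ind: y => [s' t'|y y' IHy IHy']; last by rewrite mulrDr scalerDr IHy IHy' mulrDr.
by rewrite mul_pure !tensA_scale_pure mul_pure scalerAl.
Qed.

HB.instance Definition _ := GRing.Lmodule_isLalgebra.Build K tensA tensA_scaleAl.
HB.instance Definition _ := GRing.Lalgebra_isComAlgebra.Build K tensA.

End TensorAlgebra.

Definition lrmorphism_of (K : fieldType) (S T : comAlgType K) (f : S -> T) (f1 : f 1 = 1)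
  (fM : {morph f : x y / x * y}) (fD : {morph f : x y / x + y}) (fZ : scalable f) :
  {f' : {lrmorphism S -> T} | f' =1 f}.
Proof.
have fB : zmod_morphism f.
  by move=> x y; rewrite fD; congr (_ + _); rewrite -!scaleN1r fZ.
pose A := GRing.isZmodMorphism.Build S T f fB.
pose B := GRing.isMonoidMorphism.Build S T f (conj f1 fM).
pose C := GRing.isScalable.Build K S T *:%R f fZ.
pose f' : {lrmorphism S -> T} := HB.pack f A B C.
by exists f'.
Qed.

(** * Canonical morphisms into and out of S (x) T *)

Section TensorAlgebraMorphisms.
Variables (K : fieldType) (S : comAlgType K).

Lemma tensA_inl_morph (T : comAlgType K) :
  {f : {lrmorphism S -> tensA S T} | forall s, f s = pure s 1}.
Proof.
suff [f fE] : {f : {lrmorphism S -> tensA S T} | f =1 (fun s => pure s 1 : tensA S T)}.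
  by exists f.
apply: lrmorphism_of => [//|s s'|s s'|k s].
- by rewrite mul_pure mulr1.
- exact: pureDl.
- by rewrite tensA_scale_pure pureZ.
Qed.

Lemma tensA_inr_morph (T : comAlgType K) :
  {f : {lrmorphism T -> tensA S T} | forall t, f t = pure 1 t}.
Proof.
suff [f fE] : {f : {lrmorphism T -> tensA S T} | f =1 (fun t => pure 1 t : tensA S T)}.
  by exists f.
apply: lrmorphism_of => [//|s s'|s s'|k s].
- by rewrite mul_pure mulr1.
- exact: pureDr.
- by rewrite tensA_scale_pure.
Qed.

Definition tensA_inl T := sval (tensA_inl_morph T).
Definition tensA_inr T := sval (tensA_inr_morph T).

Lemma tensA_inlE T s : tensA_inl T s = pure s 1.
Proof. exact: (svalP (tensA_inl_morph T)). Qed.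

Lemma tensA_inrE T t : tensA_inr T t = pure 1 t.
Proof. exact: (svalP (tensA_inr_morph T)). Qed.

(** Reconciles the ring structure of [tensA S T] with the T-module structure of [tens S T]; the
    T-linearity of [dual_hom] rests on it. *)
Lemma tensA_inr_mul (T : comAlgType K) (a : T) (x : tensA S T) :
  tensA_inr T a * x = a *: (x : tens S T).
Proof.
elim/tens_ind: x => [s t|x y IHx IHy]; last by rewrite mulrDr IHx IHy scalerDr.
by rewrite tensA_inrE mul_pure mul1r scale_pure.
Qed.

Lemma tensA_map_morph (T T' : comAlgType K) (f : {lrmorphism T -> T'}) :
  {g : {lrmorphism tensA S T -> tensA S T'} | forall x, g x = tens_map f x}.
Proof.
suff [g gE] : {g : {lrmorphism tensA S T -> tensA S T'} | g =1 tens_map f}.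
  by exists g.
apply: lrmorphism_of => [|x y|x y|k x].
- by rewrite tens_map_pure rmorph1.
- elim/tens_ind: x => [s t|x x' IHx IHx'].
    elim/tens_ind: y => [s' t'|y y' IHy IHy']; last by rewrite mulrDr !tens_mapD IHy IHy' mulrDr.
    by rewrite mul_pure !tens_map_pure mul_pure rmorphM.
  by rewrite mulrDl !tens_mapD IHx IHx' mulrDl.
- exact: tens_mapD.
- rewrite [LHS]tens_mapZ linearZ rmorph1; reflexivity.
Qed.

Definition tensA_map (T T' : comAlgType K) f := sval (@tensA_map_morph T T' f).

Lemma tensA_mapE (T T' : comAlgType K) (f : {lrmorphism T -> T'}) x :
  tensA_map f x = tens_map f x.
Proof. exact: (svalP (tensA_map_morph f)). Qed.

(** The multiplication S (x) T -> T of an S-algebra T, which brings data over S (x) T back to T. *)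
Lemma tensA_mu_morph (T : comAlgType K) (i : {lrmorphism S -> T}) :
  {g : {lrmorphism tensA S T -> T} | forall s t, g (pure s t) = i s * t}.
Proof.
have bb : balanced (fun s t => i s * t).
  split=> *; first by rewrite rmorphD mulrDl.
    by rewrite mulrDr.
  by rewrite linearZ -scalerAl scalerAr.
suff [g gE] : {g : {lrmorphism tensA S T -> T} | g =1 tens_lift (fun s t => i s * t)}.
  by exists g => s t; rewrite gE tens_lift_pure.
apply: lrmorphism_of => [|x y|x y|k x].
- by rewrite tens_lift_pure // rmorph1 mulr1.
- elim/tens_ind: x => [s t|x x' IHx IHx'].
    elim/tens_ind: y => [s' t'|y y' IHy IHy'].
      by rewrite mul_pure !tens_lift_pure // rmorphM mulrACA.
    by rewrite mulrDr !tens_liftD // IHy IHy' mulrDr.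
  by rewrite mulrDl !tens_liftD // IHx IHx' mulrDl.
- exact: tens_liftD.
- elim/tens_ind: x => [s t|x y IHx IHy].
    by rewrite tensA_scale_pure !tens_lift_pure // scalerAr.
  by rewrite scalerDr !tens_liftD // IHx IHy scalerDr.
Qed.

Definition tensA_mu (T : comAlgType K) i := sval (@tensA_mu_morph T i).

Lemma tensA_muE (T : comAlgType K) (i : {lrmorphism S -> T}) s t :
  tensA_mu i (pure s t) = i s * t.
Proof. exact: (svalP (tensA_mu_morph i)). Qed.

Lemma tensA_muZ (T : comAlgType K) (i : {lrmorphism S -> T}) a (x : tens S T) :
  tensA_mu i (a *: x) = a * tensA_mu i x.
Proof.
elim/tens_ind: x => [s t|x y IHx IHy]; first by rewrite scale_pure !tensA_muE mulrCA.
rewrite scalerDr; transitivity (tensA_mu i (a *: x) + tensA_mu i (a *: y)).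
  exact: (rmorphD (tensA_mu i)).
by rewrite IHx IHy -mulrDr; congr (a * _); apply/esym/(rmorphD (tensA_mu i)).
Qed.

Lemma tensA_mu_map (T T' : comAlgType K) (i : {lrmorphism S -> T}) (i' : {lrmorphism S -> T'})
    (f : {lrmorphism T -> T'}) :
  (forall a, i' a = f (i a)) ->
  forall x : tens S T, tensA_mu i' (tens_map f x) = f (tensA_mu i x).
Proof.
move=> ff'; elim/tens_ind => [s t|x y IHx IHy].
  by rewrite tens_map_pure !tensA_muE rmorphM ff'.
rewrite tens_mapD; transitivity (tensA_mu i' (tens_map f x) + tensA_mu i' (tens_map f y)).
  exact: (rmorphD (tensA_mu i')).
by rewrite IHx IHy -rmorphD; congr (f _); apply/esym/(rmorphD (tensA_mu i)).
Qed.

End TensorAlgebraMorphisms.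

(** * Square-zero extensions *)

Section SquareZero.
Variables (K : fieldType) (T : comAlgType K) (X : lmodType T).

Definition sqz := (T * X)%type.
HB.instance Definition _ := GRing.Zmodule.on sqz.
Implicit Types x y z : sqz.

Lemma sqz_eq x y : x.1 = y.1 -> x.2 = y.2 -> x = y.
Proof. exact: injective_projections. Qed.

Definition sqz_one : sqz := (1, 0).
Definition sqz_mul x y : sqz := (x.1 * y.1, x.1 *: y.2 + y.1 *: x.2).

Lemma sqz_mulA : associative sqz_mul.
Proof.
case=> [a x] [b y] [c z]; rewrite /sqz_mul /= mulrA !scalerDr !scalerA addrA.
by rewrite [c * a]mulrC [c * b]mulrC.
Qed.
Lemma sqz_mulC : commutative sqz_mul.
Proof. by case=> [a x] [b y]; rewrite /sqz_mul /= mulrC addrC. Qed.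
Lemma sqz_mul1 : left_id sqz_one sqz_mul.
Proof. by case=> [a x]; rewrite /sqz_mul /= mul1r scale1r scaler0 addr0. Qed.
Lemma sqz_mulDl : left_distributive sqz_mul +%R.
Proof.
case=> [a x] [b y] [c z]; congr (_, _); rewrite /= ?mulrDl //.
by rewrite scalerDl scalerDr addrACA.
Qed.
Lemma sqz_one_neq0 : sqz_one != 0.
Proof. by apply/eqP => -[/eqP]; rewrite oner_eq0. Qed.

HB.instance Definition _ := GRing.Zmodule_isComNzRing.Build sqz
  sqz_mulA sqz_mulC sqz_mul1 sqz_mulDl sqz_one_neq0.

Definition sqz_scale (k : K) x : sqz := (k *: x.1, k%:A *: x.2).

Lemma sqz_scaleA a b x : sqz_scale a (sqz_scale b x) = sqz_scale (a * b) x.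
Proof. by rewrite /sqz_scale /= !scalerA -scalerAl mul1r scalerA. Qed.
Lemma sqz_scale1 : left_id 1 sqz_scale.
Proof. by case=> [a x]; rewrite /sqz_scale /= !scale1r. Qed.
Lemma sqz_scaleDr : right_distributive sqz_scale +%R.
Proof. by move=> k [a x] [b y]; congr (_, _); rewrite /= scalerDr. Qed.
Lemma sqz_scaleDl x : {morph sqz_scale^~ x : a b / a + b}.
Proof. by move=> a b; congr (_, _); rewrite /= !scalerDl. Qed.

HB.instance Definition _ := GRing.Zmodule_isLmodule.Build K sqz
  sqz_scaleA sqz_scale1 sqz_scaleDr sqz_scaleDl.

Lemma sqz_scaleAl (k : K) x y : k *: (x * y) = (k *: x) * y.
Proof.
apply: sqz_eq => /=; first by rewrite scalerAl.
by rewrite scalerDr !scalerA mulr_algl [y.1 * _]mulrC.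
Qed.

HB.instance Definition _ := GRing.Lmodule_isLalgebra.Build K sqz sqz_scaleAl.
HB.instance Definition _ := GRing.Lalgebra_isComAlgebra.Build K sqz.

Lemma sqz_inl_morph : {f : {lrmorphism T -> sqz} | forall a, f a = (a, 0)}.
Proof.
suff [f fE] : {f : {lrmorphism T -> sqz} | f =1 (fun a => (a, 0) : sqz)} by exists f.
apply: lrmorphism_of => [//|a b|a b|k a]; apply: sqz_eq => //=.
- by rewrite !scaler0 addr0.
- by rewrite addr0.
- by rewrite scaler0.
Qed.

End SquareZero.

(** * Quasi-coherent modules *)

Definition restr (K : fieldType) (S T : comAlgType K) (f : {lrmorphism S -> T})
  (P : lmodType T) : Type := P.

Section RestrictionOfScalars.
Variables (K : fieldType) (S T : comAlgType K) (f : {lrmorphism S -> T}) (P : lmodType T).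

HB.instance Definition _ := GRing.Zmodule.copy (restr f P) P.

Definition restr_scale (a : S) (x : restr f P) : restr f P := f a *: (x : P).

Lemma restr_scaleA a b x : restr_scale a (restr_scale b x) = restr_scale (a * b) x.
Proof. by rewrite /restr_scale scalerA rmorphM. Qed.
Lemma restr_scale1 : left_id 1 restr_scale.
Proof. by move=> x; rewrite /restr_scale rmorph1 scale1r. Qed.
Lemma restr_scaleDr : right_distributive restr_scale +%R.
Proof. by move=> a x y; apply: scalerDr. Qed.
Lemma restr_scaleDl x : {morph restr_scale^~ x : a b / a + b}.
Proof. by move=> a b; rewrite /restr_scale rmorphD; apply: scalerDl. Qed.

HB.instance Definition _ := GRing.Zmodule_isLmodule.Build S (restr f P)
  restr_scaleA restr_scale1 restr_scaleDr restr_scaleDl.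

End RestrictionOfScalars.

(** * Subspaces as vector spaces in their own right *)

Section Submodule.
Variables (K : fieldType) (U : lmodType K) (S : submodClosed U).

Record submodule := Submodule { submodule_val : U; _ : submodule_val \in S }.

HB.instance Definition _ := [isSub for submodule_val].
HB.instance Definition _ := [Choice of submodule by <:].
HB.instance Definition _ := [SubChoice_isSubLmodule of submodule by <:].

End Submodule.

(** * Extending linear maps on N(K) to morphisms and functionals on N *)

Section KModTheory.
Variable K : fieldType.
Local Notation alg := (comAlgType K).
Local Notation hom S T := {lrmorphism S%type -> T%type}.
Implicit Types M N : KMod K.

Lemma unit_homE (f : hom K^o K^o) (a : K^o) : f a = a.
Proof. by rewrite -[a]mulr1 linearZ rmorph1. Qed.

Lemma hom_unit (S T : alg) (f : hom S T) (k : K^o) : f (unit_hom S k) = unit_hom T k.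
Proof. by rewrite /unit_hom /= /unit_map linearZ rmorph1. Qed.

Lemma kmap_unit_comp N (S T : alg) (f : hom S T) (x : N K^o) :
  kmap N f (kmap N (unit_hom S) x) = kmap N (unit_hom T) x.
Proof. by apply/esym/kmap_comp => a; rewrite hom_unit. Qed.

Lemma kmap_lin N (S T : alg) (f : hom S T) a (x y : N S) :
  kmap N f (a *: x + y) = f a *: kmap N f x + kmap N f y.
Proof. by rewrite kmapD kmapZ. Qed.

Lemma hcomp_lin M N (p : KHom M N) (S : alg) a (x y : M S) :
  p S (a *: x + y) = a *: p S x + p S y.
Proof. by rewrite hcompD hcompZ. Qed.

Definition khom_comp M N N' (q : KHom N N') (p : KHom M N) : KHom M N'.
Proof.
exists (fun S x => q S (p S x)) => [S x y|S a x|S T f x].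
- by rewrite !hcompD.
- by rewrite !hcompZ.
- by rewrite !hcomp_nat.
Defined.

Definition dual_comp M N (S : alg) (v : dual_elt N S) (p : KHom M N) : dual_elt M S.
Proof.
exists (fun T i x => dcomp v i (p T x)) => [T i x y|T i a x|T T' i i' f ff' x].
- by rewrite hcompD dcompD.
- by rewrite hcompZ dcompZ.
- by rewrite hcomp_nat (dcomp_nat v ff').
Defined.

Lemma linear_additive (R : nzRingType) (X Y : lmodType R) (h : X -> Y) :
  linear h -> {morph h : x y / x + y}.
Proof. by move=> hlin x y; rewrite -[x]scale1r hlin !scale1r. Qed.

Lemma linear_scalable (R : nzRingType) (X Y : lmodType R) (h : X -> Y) :
  linear h -> scalable h.
Proof.
move=> hlin a x; have h0 : h 0 = 0.
  by apply: (addrI (h 0)); rewrite -(linear_additive hlin) !addr0.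
by rewrite -[in LHS](addr0 (a *: x)) hlin h0 addr0.
Qed.

(** The existence half of quasi-coherence produces each component, and the uniqueness half proves
    naturality. *)
Lemma qc_hom_ext N N' (phi : N K^o -> N' K^o) :
  quasi_coherent N -> linear phi ->
  exists E : KHom N N', forall x : N K^o, E K^o x = phi x.
Proof.
move=> Nqc phi_lin.
have step (T : alg) : exists h : N T -> N' T,
    linear h /\ forall x, h (kmap N (unit_hom T) x) = kmap N' (unit_hom T) (phi x).
  apply: (Nqc T (N' T) (fun x => kmap N' (unit_hom T) (phi x)) _).1 => k x y.
  by rewrite phi_lin kmap_lin.
pose h T := sval (cid (step T)).
have hlin T : linear (h T) by rewrite /h; case: cid => ? [].
have hE T x : h T (kmap N (unit_hom T) x) = kmap N' (unit_hom T) (phi x).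
  by rewrite /h; case: cid => ? [].
have h_nat (S T : alg) (f : hom S T) (x : N S) : h T (kmap N f x) = kmap N' f (h S x).
  (* With N'(T) viewed as an S-module along [f], both sides are S-linear maps on N(S), so it
     suffices to compare them on N(K). *)
  pose P := restr f (N' T).
  apply: ((Nqc S P (fun x => h T (kmap N (unit_hom T) x)) _).2
    (fun x => h T (kmap N f x)) (fun x => kmap N' f (h S x))).
  - by move=> k u v; rewrite !hE phi_lin kmap_lin -(hom_unit f).
  - by move=> a u v; rewrite kmap_lin hlin.
  - by move=> a u v; rewrite hlin kmap_lin.
  - by move=> u; rewrite kmap_unit_comp !hE kmap_unit_comp.
exists (@Build_KHom K N N' h (fun T => linear_additive (hlin T))
  (fun T => linear_scalable (hlin T)) h_nat) => x /=.
rewrite -[x in LHS](kmap_id (k := N) (f := unit_hom K^o)) ?hE; last exact: unit_homE.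
by apply: kmap_id; apply: unit_homE.
Qed.

(** Surjectivity of N^*(S) -> Hom_K(N(K), S) for quasi-coherent N, by the scheme of [qc_hom_ext]
    with each S-algebra T as a module over itself. *)
Lemma qc_dual_ext N (S : alg) (g : N K^o -> S) :
  quasi_coherent N -> (forall (k : K) x y, g (k *: x + y) = k *: g x + g y) ->
  exists u : dual_elt N S, forall (T : alg) (i : hom S T) x,
    dcomp u i (kmap N (unit_hom T) x) = i (g x).
Proof.
move=> Nqc glin.
have step (T : alg) (i : hom S T) : exists h : N T -> T^o,
    linear h /\ forall x, h (kmap N (unit_hom T) x) = i (g x).
  apply: (Nqc T T^o (fun x => i (g x)) _).1 => k x y.
  by rewrite glin linearP [unit_map _ _ *: _]mulr_algl.
pose h T i := sval (cid (step T i)).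
have hlin T i : linear (h T i) by rewrite /h; case: cid => ? [].
have hE T i x : h T i (kmap N (unit_hom T) x) = i (g x).
  by rewrite /h; case: cid => ? [].
have h_nat (T T' : alg) (i : hom S T) (i' : hom S T') (f : hom T T') :
    (forall a, i' a = f (i a)) -> forall x, h T' i' (kmap N f x) = f (h T i x).
  move=> ff'; pose P := restr f T'^o.
  apply: ((Nqc T P (fun x => i' (g x)) _).2
    (fun x => h T' i' (kmap N f x)) (fun x => f (h T i x))).
  - move=> k u v; rewrite glin linearP -mulr_algl; congr (_ * _ + _).
    by rewrite -[unit_map _ _]/(unit_hom _ _) hom_unit.
  - by move=> a u v; rewrite kmap_lin hlin.
  - by move=> a u v; rewrite hlin rmorphD rmorphM.
  - by move=> u; rewrite kmap_unit_comp !hE ff'.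
by exists (@Build_dual_elt K N S h (fun T i => linear_additive (hlin T i))
  (fun T i => linear_scalable (hlin T i)) h_nat).
Qed.

End KModTheory.

(** * Dually separated modules *)

Section DuallySeparated.
Variable K : fieldType.
Local Notation alg := (comAlgType K).
Local Notation hom S T := {lrmorphism S%type -> T%type}.
Implicit Types M N : KMod K.

(** This makes T (+) N(T) an algebra over K (+) N(K), so that functionals defined over the latter
    can be evaluated there. *)
Lemma sqz_map_morph N (T : alg) :
  {f : hom (sqz (N K^o)) (sqz (N T)) |
     forall x, f x = (unit_hom T x.1, kmap N (unit_hom T) x.2)}.
Proof.
suff [f fE] : {f : hom (sqz (N K^o)) (sqz (N T)) |
    f =1 (fun x => (unit_hom T x.1, kmap N (unit_hom T) x.2) : sqz (N T))} by exists f.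
apply: lrmorphism_of => [|x y|x y|k x]; apply: sqz_eq => /=.
- by rewrite rmorph1.
- by apply: (addrI (kmap N (unit_hom T) 0)); rewrite -kmapD !addr0.
- by rewrite rmorphM.
- by rewrite kmapD !kmapZ.
- by rewrite rmorphD.
- by rewrite kmapD.
- by rewrite linearZ.
- by rewrite kmapZ; congr (_ *: _); rewrite linearZ /= rmorph1.
Qed.

(* Two morphisms to N differ by an N(T)-valued map, which is detected by a
   functional defined over the square-zero extension K (+) N(K). *)
Lemma dually_separated_hom_eq M N (p p' : KHom M N) :
  dually_separated M -> quasi_coherent N ->
  (forall x : M K^o, p K^o x = p' K^o x) -> forall (T : alg) x, p T x = p' T x.
Proof.
move=> Msep Nqc pp' T x; pose S : alg := sqz (N K^o).
have [|u uE] := @qc_dual_ext K N S (fun n => (0, n) : S) Nqc.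
  move=> k n n'; apply: sqz_eq => /=; first by rewrite scaler0 addr0.
  by congr (_ *: _ + _); rewrite [RHS]mulr1.
have upp' : dual_eq (dual_comp u p) (dual_comp u p').
  by apply: Msep => m /=; rewrite !hcomp_nat pp'.
have [inl inlE] := sqz_inl_morph (N T).
have [i iE] := sqz_map_morph N T.
(* Over T (+) N(T) the functional [u] returns [y] itself: both sides are T-linear in [y] along [inl]
   and agree on N(K). *)
have uT y : dcomp u i (kmap N inl y) = (0, y).
  pose P := restr inl (sqz (N T))^o.
  apply: ((Nqc T P (fun n => ((0, kmap N (unit_hom T) n) : sqz (N T))) _).2
    (fun y => dcomp u i (kmap N inl y)) (fun y => ((0, y) : sqz (N T)))).
  - move=> k n n'; rewrite kmap_lin; apply: sqz_eq => /=.
      by rewrite !inlE /= mulr0 addr0.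
    by rewrite !inlE /= scaler0 addr0.
  - by move=> a n n'; rewrite kmap_lin dcompD dcompZ.
  - move=> a n n'; apply: sqz_eq => /=; first by rewrite !inlE /= mulr0 addr0.
    by rewrite !inlE /= scale0r addr0.
  - by move=> n; rewrite kmap_unit_comp uE iE /= rmorph0.
have := upp' _ i (kmap M inl x).
by rewrite /= !hcomp_nat !uT => -[].
Qed.

Lemma quot_of_hom M N (p : KHom M N) :
  dually_separated M -> quasi_coherent N ->
  exists (Q : Quot M) (j : KHom (qmod Q) N), forall (T : alg) x, j T (qpi Q T x) = p T x.
Proof.
move=> Msep Nqc.
pose U : lmodType K := N K^o.
pose W (y : U) := exists x : M K^o, p K^o x = y.
have p0 : p K^o 0 = 0 by apply: (addrI (p K^o 0)); rewrite -hcompD !addr0.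
have W0 : W 0 by exists 0.
have Wlin k x y : W x -> W y -> W (k *: x + y).
  by move=> [a <-] [b <-]; exists (k *: a + b); apply: hcomp_lin.
have [e [elin eW eK]] := subspace_projection W0 Wlin.
have Wsub : submod_closed (fun y => `[< W y >]).
  split=> [|k x y]; first exact/asboolP.
  by rewrite !unfold_in => /asboolP Wx /asboolP Wy; apply/asboolP/Wlin.
pose S : submodClosed U := HB.pack (fun y => `[< W y >]) (GRing.isSubmodClosed.Build K U _ Wsub).
pose V : lmodType K := submodule S.
have eS y : e y \in S by apply/asboolP.
pose e' y : V := Submodule (eS y).
have e'lin k x y : e' (k *: x + y) = k *: e' x + e' y.
  by apply: val_inj; rewrite /= elin.
have [|E EE] := @qc_hom_ext K N (tensMod V) (fun y => pure (e' y) (1 : K^o)) Nqc.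
  by move=> k x y; rewrite e'lin pureDl pureZ scale_pure.
pose ev (v : V) : N K^o := val v.
have evD v v' : ev (v + v') = ev v + ev v' by [].
have evZ (k : K) v : ev (k *: v) = (k : K^o) *: ev v by [].
have bb : balanced (fun (v : V) (k : K^o) => k *: ev v).
  split=> [v v' k|v k k'|k v k']; first by rewrite evD scalerDr.
    by rewrite scalerDl.
  by rewrite evZ scalerA mulrC.
have [|j jE] := @qc_hom_ext K (tensMod V) N
    (tens_lift (fun (v : V) (k : K^o) => k *: ev v)) (@tensMod_quasi_coherent K V).
  move=> k x y; rewrite tens_liftD //; congr (_ + _).
  elim/tens_ind: x => [v t|x x' IHx IHx']; last by rewrite scalerDr !tens_liftD // IHx IHx' scalerDr.
  by rewrite scale_pure !tens_lift_pure // scalerA.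
(* Corestricting [p] directly would require its values over every T to lie in V (x) T, which is
   known only at K; composing with the extended projection [E] is always possible. *)
pose q := khom_comp E p.
have q_epi : epi q.
  move=> T; elim/tens_ind=> [v t|y y' [x <-] [x' <-]]; last first.
    by exists (x + x'); apply: hcompD.
  (* The vector [v] is the image of some [x0] in M(K), so v (x) t is hit by [t] times the image of
     [x0] in M(T). *)
  have /asboolP[x0 px0] := valP v.
  exists (t *: kmap M (unit_hom T) x0); rewrite hcompZ hcomp_nat /= EE.
  rewrite tens_map_pure scale_pure rmorph1 mulr1; congr pure.
  by apply: val_inj; rewrite /= px0; apply: eK; exists x0.
exists (Build_Quot (@tensMod_quasi_coherent K V) q_epi), j => T x /=.
(* On M(K) the two morphisms agree because [e] fixes the image of [p]. *)
apply: (@dually_separated_hom_eq _ _ (khom_comp j q) p) => // {T}x /=.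
rewrite EE jE tens_lift_pure // scale1r.
by apply: eK; exists x.
Qed.

(** For a section [s] of M(K) -> Q(K), the kernel condition makes [p] after [s] linear, so it
    extends to Q. The triangle commutes because it does so on M(K). Inclusion of kernels on M(K)
    thus suffices to compare two quotients. *)
Lemma quot_hom_exists M (Q : Quot M) N (p : KHom M N) :
  dually_separated M -> quasi_coherent N ->
  (forall x : M K^o, qpi Q K^o x = 0 -> p K^o x = 0) ->
  exists phi : KHom (qmod Q) N, forall (T : alg) x, phi T (qpi Q T x) = p T x.
Proof.
move=> Msep Nqc ker_le; have [s sK] := choice (@qepi _ _ Q K^o).
have pE x y : qpi Q K^o x = qpi Q K^o y -> p K^o x = p K^o y.
  move=> xy; apply/eqP; rewrite -subr_eq0 -scaleN1r addrC -hcomp_lin; apply/eqP.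
  by apply: ker_le; rewrite hcomp_lin xy scaleN1r addNr.
have [|phi phiE] := @qc_hom_ext K (qmod Q) N (fun y => p K^o (s y)) (@qqc _ _ Q).
  by move=> k x y; rewrite -hcomp_lin; apply: pE; rewrite hcomp_lin !sK.
exists phi => T x.
apply: (@dually_separated_hom_eq _ _ (khom_comp phi (qpi Q)) p) => // {T}x /=.
by rewrite phiE; apply: pE; rewrite sK.
Qed.

Lemma quot_le_ker M (Q1 Q2 : Quot M) : dually_separated M ->
  (forall x : M K^o, qpi Q1 K^o x = 0 -> qpi Q2 K^o x = 0) -> quot_le Q1 Q2.
Proof. by move=> Msep; apply: quot_hom_exists => //; apply: qqc. Qed.

Lemma quot_iso_le M (Q1 Q2 : Quot M) : quot_le Q1 Q2 -> quot_le Q2 Q1 -> quot_iso Q1 Q2.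
Proof.
move=> [phi phiE] [psi psiE]; exists phi, psi; split=> // T y.
  by have [x <-] := @qepi _ _ Q1 T y; rewrite phiE psiE.
by have [x <-] := @qepi _ _ Q2 T y; rewrite psiE phiE.
Qed.

Definition prodMod N1 N2 : KMod K.
Proof.
exists (fun T : alg => (N1 T * N2 T)%type : lmodType T)
  (fun (S T : alg) (f : hom S T) x => (kmap N1 f x.1, kmap N2 f x.2)).
- by move=> S T f x y; congr (_, _); apply: kmapD.
- by move=> S T f a x; congr (_, _); apply: kmapZ.
- by move=> S f fE [x y]; rewrite /= !kmap_id.
- by move=> S T U f g h hE x; congr (_, _); apply: kmap_comp.
Defined.

Definition prod_fst N1 N2 : KHom (prodMod N1 N2) N1.
Proof. by exists (fun (T : alg) (x : N1 T * N2 T) => x.1). Defined.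

Definition prod_snd N1 N2 : KHom (prodMod N1 N2) N2.
Proof. by exists (fun (T : alg) (x : N1 T * N2 T) => x.2). Defined.

Definition prod_pair M N1 N2 (p1 : KHom M N1) (p2 : KHom M N2) : KHom M (prodMod N1 N2).
Proof.
exists (fun (T : alg) x => (p1 T x, p2 T x)) => *; congr (_, _);
  by rewrite ?hcompD ?hcompZ ?hcomp_nat.
Defined.

(** Scalar extension commutes with finite direct sums: extend [g] on each summand and add the
    results. *)
Lemma prodMod_quasi_coherent N1 N2 :
  quasi_coherent N1 -> quasi_coherent N2 -> quasi_coherent (prodMod N1 N2).
Proof.
move=> qc1 qc2 T P g glin.
have k0 N (S S' : alg) (f : hom S S') : kmap N f 0 = 0.
  by apply: (addrI (kmap N f 0)); rewrite -kmapD !addr0.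
have gD x y : g (x + y) = g x + g y.
  by rewrite -[x]scale1r glin /unit_map !scale1r.
have g1lin (k : K^o) (x y : N1 K^o) :
    g (k *: x + y, 0) = unit_map T k *: g (x, 0) + g (y, 0).
  by rewrite -glin; congr (g (_, _)); rewrite /= scaler0 addr0.
have g2lin (k : K^o) (x y : N2 K^o) :
    g (0, k *: x + y) = unit_map T k *: g (0, x) + g (0, y).
  by rewrite -glin; congr (g (_, _)); rewrite /= scaler0 addr0.
have [[h1 [h1lin h1E]] uniq1] := qc1 T P (fun x => g (x, 0)) g1lin.
have [[h2 [h2lin h2E]] uniq2] := qc2 T P (fun x => g (0, x)) g2lin.
split=> [|h h' hlin h'lin hh' [y1 y2]].
  exists (fun x => h1 x.1 + h2 x.2); split=> [a x y|[x1 x2]] /=.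
    by rewrite h1lin h2lin scalerDr addrACA.
  by rewrite h1E h2E -gD; congr (g (_, _)); rewrite /= ?addr0 ?add0r.
have split_eq f : (forall a x y, f (a *: x + y) = a *: f x + f y) ->
    f (y1, y2) = f (y1, 0) + f (0, y2) :> P.
  move=> flin; rewrite -[f (y1, 0)]scale1r -flin.
  by congr (f (_, _)); rewrite /= scale1r ?addr0 ?add0r.
rewrite (split_eq h) // (split_eq h') //; congr (_ + _).
  apply: (uniq1 (fun y => h (y, 0)) (fun y => h' (y, 0))) => [a x y|a x y|x].
  - by rewrite -hlin; congr (h (_, _)); rewrite /= scaler0 addr0.
  - by rewrite -h'lin; congr (h' (_, _)); rewrite /= scaler0 addr0.
  - by have := hh' (x, 0); rewrite /= k0.
apply: (uniq2 (fun y => h (0, y)) (fun y => h' (0, y))) => [a x y|a x y|x].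
- by rewrite -hlin; congr (h (_, _)); rewrite /= scaler0 addr0.
- by rewrite -h'lin; congr (h' (_, _)); rewrite /= scaler0 addr0.
- by have := hh' (0, x); rewrite /= k0.
Qed.

Lemma dually_separated_directed M : dually_separated M -> quotients_directed M.
Proof.
move=> Msep; split=> [|Q1 Q2].
  (* The family of quotients is inhabited because the zero morphism factors through one. *)
  pose U : lmodType K := K^o.
  have zero : KHom M (tensMod U).
    by exists (fun (T : alg) _ => 0) => [T x y|T a x|T T' f x]; rewrite ?addr0 ?scaler0 //;
      apply: (addrI (kmap (tensMod U) f 0)); rewrite -kmapD !addr0.
  by have [Q _] := quot_of_hom zero Msep (@tensMod_quasi_coherent K U).
have [|Q [j jE]] := @quot_of_hom _ _ (prod_pair (qpi Q1) (qpi Q2)) Msep.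
  by apply: prodMod_quasi_coherent; apply: qqc.
exists Q; split.
  by exists (khom_comp (prod_fst _ _) j) => T x /=; rewrite jE.
by exists (khom_comp (prod_snd _ _) j) => T x /=; rewrite jE.
Qed.

Lemma dually_separated_small M : dually_separated M -> quotients_small M.
Proof.
move=> Msep; have [[Q0] _] := dually_separated_directed Msep.
pose ker (Q : Quot M) (x : M K^o) : bool := qpi Q K^o x == 0.
(* Quotients are indexed by predicates on M(K); one that is the kernel of no quotient receives the
   default [Q0]. *)
have ex (J : M K^o -> bool) : exists Q, (exists Q', ker Q' = J) -> ker Q = J.
  by have [[Q QJ]|nJ] := pselect (exists Q, ker Q = J); [exists Q|exists Q0].
exists (M K^o -> bool), (fun J => sval (cid (ex J))) => Q; exists (ker Q).
case: cid => Q' /= /(_ (ex_intro _ Q erefl)) kerQ.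
have kerE x : (qpi Q' K^o x == 0) = (qpi Q K^o x == 0) by rewrite -/(ker Q' x) kerQ.
by apply: quot_iso_le; apply: quot_le_ker => // x /eqP qx; apply/eqP; move: qx; rewrite kerE.
Qed.

End DuallySeparated.

(** * Functionals on M as morphisms to quasi-coherent modules, and the colimit of the duals *)

Section MainTheorem.
Variables (K : fieldType) (M : KMod K).
Local Notation alg := (comAlgType K).
Local Notation hom S T := {lrmorphism S%type -> T%type}.

(* The element w of M^*(S), read as a morphism from M to the quasi-coherent
   module of S: apply w over the S-algebra S (x) T to the image of x in M(S (x) T). *)
Definition dual_hom (S : alg) (w : dual_elt M S) : KHom M (tensMod S).
Proof.
exists (fun (T : alg) (x : M T) => dcomp w (tensA_inl S T) (kmap M (tensA_inr S T) x) : tens S T).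
- by move=> T x y; rewrite kmapD dcompD.
- by move=> T a x; rewrite kmapZ dcompZ tensA_inr_mul.
move=> T T' f x.
have fE : kmap M (tensA_inr S T') (kmap M f x)
          = kmap M (tensA_map S f) (kmap M (tensA_inr S T) x).
  pose h : hom T (tensA S T') := tensA_map S f \o tensA_inr S T.
  rewrite -(@kmap_comp _ M _ _ _ (tensA_inr S T) (tensA_map S f) h) //; apply/esym/kmap_comp => t.
  by rewrite /h /= tensA_mapE !tensA_inrE tens_map_pure.
rewrite fE /= -tensA_mapE; apply: (@dcomp_nat _ _ _ w _ _ _ (tensA_inl S T') (tensA_map S f)) => s.
by rewrite tensA_mapE !tensA_inlE tens_map_pure rmorph1.
Defined.

(** Recovers [w] from its adjoint: apply naturality of [w] along S (x) T -> T, whose composite with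
    T -> S (x) T is the identity. *)
Lemma dual_hom_mu (S : alg) (w : dual_elt M S) (T : alg) (i : hom S T) (x : M T) :
  tensA_mu i (dual_hom w T x) = dcomp w i x.
Proof.
rewrite /= -(@dcomp_nat _ _ _ w _ _ _ i); last first.
  by move=> s; rewrite tensA_inlE (tensA_muE i s 1) mulr1.
pose h : hom T T := tensA_mu i \o tensA_inr S T.
rewrite -(@kmap_comp _ M _ _ _ (tensA_inr S T) (tensA_mu i) h) // kmap_id // => t.
by rewrite /h /= tensA_inrE (tensA_muE i 1 t) rmorph1 mul1r.
Qed.

(** The tautological functional on the quasi-coherent module of S, corresponding to the identity of
    S. *)
Definition mu_dual (S : alg) : dual_elt (tensMod S) S.
Proof.
exists (fun (T : alg) (i : hom S T) (x : tens S T) => tensA_mu i x).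
- by move=> T i x y; apply: rmorphD.
- by move=> T i a x; apply: tensA_muZ.
- by move=> T T' i i' f ff' x; apply: tensA_mu_map.
Defined.

Lemma dually_separated_colimit : dually_separated M -> dual_colimit_iso M.
Proof.
move=> Msep S; split=> [w|Q1 Q2 v1 v2 v12].
  have [Q [j jE]] := quot_of_hom (dual_hom w) Msep (@tensMod_quasi_coherent K S).
  exists Q, (dual_comp (mu_dual S) j) => T i x /=.
  by rewrite jE dual_hom_mu.
have [_ /(_ Q1 Q2) [Q3 [[t1 t1E] [t2 t2E]]]] := dually_separated_directed Msep.
(* Any common lower bound works: M maps onto it, so equality of the two functionals on M
   descends. *)
exists Q3, t1, t2; split=> // T i y.
by have [x <-] := @qepi _ _ Q3 T y; rewrite t1E t2E.
Qed.

(** A T-linear map on N(T) is determined on the image of N(K), and naturality along [i] moves that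
    comparison from T back to S. *)
Lemma qc_dually_separated (N : KMod K) : quasi_coherent N -> dually_separated N.
Proof.
move=> Nqc S v v' vv' T i.
pose g (w : dual_elt N S) x := dcomp w i (kmap N (unit_hom T) x).
apply: ((Nqc T T^o (g v) _).2 (dcomp v i) (dcomp v' i)).
- by move=> k x y; rewrite /g kmap_lin dcompD dcompZ.
- by move=> a x y; rewrite dcompD dcompZ.
- by move=> a x y; rewrite dcompD dcompZ.
move=> x; rewrite -(kmap_unit_comp i) !(@dcomp_nat _ _ _ _ _ _ (id_hom S) i i) //.
by rewrite vv'.
Qed.

Lemma colimit_dually_separated :
  quotients_directed M -> dual_colimit_iso M -> dually_separated M.
Proof.
move=> [_ dir] colim S w w' ww'.
have [[Q1 [v1 v1E]] [Q2 [v2 v2E]]] := ((colim S).1 w, (colim S).1 w').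
have [Q [[t1 t1E] [t2 t2E]]] := dir Q1 Q2.
suff v12 : dual_eq (dual_comp v1 t1) (dual_comp v2 t2).
  by move=> T i x; rewrite v1E v2E -t1E -t2E; apply: v12.
(* Both functionals now live on the common quotient [Q]; they agree on Q(K) because M(K) maps onto
   it. *)
apply: (qc_dually_separated (@qqc _ _ Q)) => y.
have [x <-] := @qepi _ _ Q K^o y.
by rewrite -hcomp_nat /= t1E t2E -v1E -v2E; apply: ww'.
Qed.

End MainTheorem.

Theorem theorem3p16 (K : fieldType) (M : KMod K) :
  dually_separated M <->
  [/\ quotients_small M, quotients_directed M & dual_colimit_iso M].
Proof.
split=> [Msep|[_ dir colim]]; last exact: colimit_dually_separated.
split; [exact: dually_separated_small | exact: dually_separated_directed |].
exact: dually_separated_colimit.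
Qed.
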